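(* Let $a=\{a_n\}_{n\ge 1}$ be a sequence of real or complex numbers, and let $r=\{r_n\}_{n\ge1}$ and $s=\{s_n\}_{n\ge1}$ be bounded sequences of strictly positive real numbers. The Rhaly operator $R_a : c_0(r)\to c_0(s)$ is bounded if and only if $$\left\{ s_n a_n \sum_{k=1}^{n}\frac{1}{r_k}\right\}_{n\in\mathbb{N}} \in \ell_\infty,$$ and in this case $$\|R_a\|_{r,s}=\sup_n\, s_n|a_n|\sum_{k=1}^{n}\frac{1}{r_k}.$$
   Context: $\mathbb{N}=\{1,2,\dots\}$. For a sequence $r=\{r_n\}$ of strictly positive reals, $c_0(r)=\{\{x_k\}\in\mathbb{C}^{\mathbb{N}}:\lim_{k\to\infty} r_kx_k=0\}$, a Banach space with norm $\|x\|_r=\sup_k |x_k|r_k$. The Rhaly operator $R_a$ is given by the lower triangular terraced matrix whose $n$-th row is $(a_n,\dots,a_n,0,0,\dots)$ with $n$ entries equal to $a_n$, i.e. $(R_ax)_n=a_n\sum_{k=1}^n x_k$. ''$R_a:c_0(r)\to c_0(s)$ is bounded'' means that $R_a$ maps $c_0(r)$ into $c_0(s)$ as a bounded linear operator. $\|T\|_{r,s}$ denotes the operator norm of $T:c_0(r)\to c_0(s)$. *)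

(* Defs.v *)
(* Sequences indexed by {1, 2, ...} are encoded with a shift:  u n : nat -> _  is
   the (n+1)-st term, so that  sum_n u n = u 0 + ... + u n  is the sum of the
   first n+1 terms. *)
From Stdlib Require Import Reals Lra FunctionalExtensionality ProofIrrelevance.
From Coquelicot Require Export Coquelicot.

(* On C and on R this is membership in l_infty: there [norm] is [Cmod], resp. [Rabs]. *)
Definition bounded_seq {K : AbsRing} {V : NormedModule K} (u : nat -> V) : Prop :=
  exists M : R, forall n : nat, (norm (u n) <= M)%R.

Record c0 (r : nat -> posreal) : Type := mk_c0 {
  c0_seq :> nat -> C;
  c0_lim : filterlim (fun k => (RtoC (r k) * c0_seq k)%C) eventually (locally (RtoC 0)) }.

Lemma c0_eq (r : nat -> posreal) (x y : c0 r) : (forall k, x k = y k) -> x = y.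
Proof.
destruct x as [x hx]; destruct y as [y hy]; simpl; intros H.
assert (E : x = y) by (apply functional_extensionality; exact H).
subst y; f_equal; apply proof_irrelevance.
Qed.

Section C0Space.

Variable r : nat -> posreal.

Lemma c0_zero_lim :
  filterlim (fun k : nat => (RtoC (r k) * RtoC 0)%C) eventually (locally (RtoC 0)).
Proof.
apply filterlim_ext with (fun _ : nat => RtoC 0).
- intros k; ring.
- apply filterlim_const.
Qed.

Lemma c0_plus_lim (x y : c0 r) :
  filterlim (fun k => (RtoC (r k) * (x k + y k))%C) eventually (locally (RtoC 0)).
Proof.
apply filterlim_ext with
  (fun k => @plus C_NormedModule (RtoC (r k) * x k)%C (RtoC (r k) * y k)%C).
- intros k; change (RtoC (r k) * x k + RtoC (r k) * y k = RtoC (r k) * (x k + y k))%C; ring.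
- replace (RtoC 0) with (@plus C_NormedModule (RtoC 0) (RtoC 0))
    by (change (RtoC 0 + RtoC 0 = RtoC 0)%C; ring).
  exact (filterlim_comp_2 _ _ _ (c0_lim r x) (c0_lim r y)
           (@filterlim_plus _ C_NormedModule (RtoC 0) (RtoC 0))).
Qed.

Lemma c0_scal_lim (c : C) (x : c0 r) :
  filterlim (fun k => (RtoC (r k) * (c * x k))%C) eventually (locally (RtoC 0)).
Proof.
apply filterlim_ext with (fun k => @scal C_Ring C_NormedModule c (RtoC (r k) * x k)%C).
- intros k; change (c * (RtoC (r k) * x k) = RtoC (r k) * (c * x k))%C; ring.
- replace (RtoC 0) with (@scal C_Ring C_NormedModule c (RtoC 0))
    by (change (c * RtoC 0 = RtoC 0)%C; ring).
  exact (filterlim_comp _ _ _ _ _ _ _ _ (c0_lim r x)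
           (@filterlim_scal_r _ C_NormedModule c (RtoC 0))).
Qed.

Lemma c0_opp_lim (x : c0 r) :
  filterlim (fun k => (RtoC (r k) * (- x k))%C) eventually (locally (RtoC 0)).
Proof.
apply filterlim_ext with (fun k => (RtoC (r k) * (- RtoC 1 * x k))%C).
- intros k; ring.
- apply c0_scal_lim.
Qed.

Definition c0_zero : c0 r := mk_c0 r _ c0_zero_lim.
Definition c0_plus (x y : c0 r) : c0 r := mk_c0 r _ (c0_plus_lim x y).
Definition c0_opp (x : c0 r) : c0 r := mk_c0 r _ (c0_opp_lim x).
Definition c0_scal (c : C) (x : c0 r) : c0 r := mk_c0 r _ (c0_scal_lim c x).

(* The supremum is finite for every x in c0 r, see [c0_norm_ub]. *)
Definition c0_norm (x : c0 r) : R :=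
  real (Sup_seq (fun k => Finite (Cmod (x k) * r k))).

Lemma c0_bounded (x : c0 r) : exists M : R, forall k, (Cmod (x k) * r k <= M)%R.
Proof.
assert (H := filterlim_comp _ _ _ _ _ _ _ _ (c0_lim r x)
               (@filterlim_norm _ C_NormedModule (RtoC 0))).
change (is_lim_seq (fun k => Cmod (RtoC (r k) * x k)%C) (Cmod (RtoC 0))) in H.
destruct (filterlim_bounded (V := R_NormedModule)
            (fun k => Cmod (RtoC (r k) * x k)%C)) as [M HM].
{ exists (Cmod (RtoC 0)); exact H. }
exists M; intros k; specialize (HM k).
change (Rabs (Cmod (RtoC (r k) * x k)%C) <= M)%R in HM.
rewrite Rabs_pos_eq in HM by apply Cmod_ge_0.
rewrite Cmod_mult, Cmod_R, Rabs_pos_eq in HM by (apply Rlt_le, cond_pos).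
lra.
Qed.

Lemma c0_norm_lub (x : c0 r) :
  is_sup_seq (fun k => Finite (Cmod (x k) * r k)) (Finite (c0_norm x)).
Proof.
unfold c0_norm.
assert (H := Sup_seq_correct (fun k => Finite (Cmod (x k) * r k))).
destruct (c0_bounded x) as [M HM].
destruct (Sup_seq _) as [l | | ]; simpl.
- exact H.
- destruct (H M) as [k Hk]; simpl in Hk; specialize (HM k); lra.
- exfalso; specialize (H (Cmod (x 0%nat) * r 0%nat)%R 0%nat); simpl in H; lra.
Qed.

Lemma c0_norm_ub (x : c0 r) (k : nat) : (Cmod (x k) * r k <= c0_norm x)%R.
Proof.
exact (is_sup_seq_major _ _ k (c0_norm_lub x)).
Qed.

Lemma c0_norm_le (x : c0 r) (M : R) :
  (forall k, (Cmod (x k) * r k <= M)%R) -> (c0_norm x <= M)%R.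
Proof.
intros H.
destruct (Rle_or_lt (c0_norm x) M) as [h | h]; [exact h | exfalso].
destruct (c0_norm_lub x (mkposreal (c0_norm x - M) ltac:(lra))) as [_ [k Hk]].
simpl in Hk; specialize (H k); lra.
Qed.

Lemma c0_norm_pos (x : c0 r) : (0 <= c0_norm x)%R.
Proof.
apply Rle_trans with (2 := c0_norm_ub x 0%nat).
apply Rmult_le_pos; [apply Cmod_ge_0 | apply Rlt_le, cond_pos].
Qed.

Lemma c0_norm_triangle (x y : c0 r) :
  (c0_norm (c0_plus x y) <= c0_norm x + c0_norm y)%R.
Proof.
apply c0_norm_le; intros k; simpl.
assert (H := Cmod_triangle (x k) (y k)).
assert (Hx := c0_norm_ub x k); assert (Hy := c0_norm_ub y k).
assert (Hr := cond_pos (r k)).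
apply Rle_trans with ((Cmod (x k) + Cmod (y k)) * r k)%R; [|lra].
apply Rmult_le_compat_r; lra.
Qed.

Lemma c0_norm_scal (c : C) (x : c0 r) :
  (c0_norm (c0_scal c x) <= Cmod c * c0_norm x)%R.
Proof.
apply c0_norm_le; intros k; simpl.
rewrite Cmod_mult, Rmult_assoc.
apply Rmult_le_compat_l; [apply Cmod_ge_0 | apply c0_norm_ub].
Qed.

Lemma c0_norm_zero : c0_norm c0_zero = 0%R.
Proof.
apply Rle_antisym; [|apply c0_norm_pos].
apply c0_norm_le; intros k; simpl; rewrite Cmod_0; lra.
Qed.

Lemma c0_norm_eq_0 (x : c0 r) : c0_norm x = 0%R -> x = c0_zero.
Proof.
intros H; apply c0_eq; intros k; simpl.
apply Cmod_eq_0.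
assert (Hk := c0_norm_ub x k); assert (H0 := Cmod_ge_0 (x k)).
assert (Hr := cond_pos (r k)).
destruct (Rle_lt_or_eq_dec _ _ H0) as [h | h]; [|now symmetry].
assert (0 < Cmod (x k) * r k)%R by (apply Rmult_lt_0_compat; assumption).
lra.
Qed.

Definition c0_AbelianMonoid_mixin : AbelianMonoid.mixin_of (c0 r).
Proof.
apply (AbelianMonoid.Mixin (c0 r) c0_plus c0_zero).
- intros x y; apply c0_eq; intros k; simpl; ring.
- intros x y z; apply c0_eq; intros k; simpl; ring.
- intros x; apply c0_eq; intros k; simpl; ring.
Defined.

Canonical c0_AbelianMonoid := AbelianMonoid.Pack (c0 r) c0_AbelianMonoid_mixin (c0 r).

Definition c0_AbelianGroup_mixin : AbelianGroup.mixin_of c0_AbelianMonoid.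
Proof.
apply (AbelianGroup.Mixin c0_AbelianMonoid c0_opp).
intros x; apply c0_eq; intros k; simpl; ring.
Defined.

Canonical c0_AbelianGroup :=
  AbelianGroup.Pack (c0 r) (AbelianGroup.Class _ _ c0_AbelianGroup_mixin) (c0 r).

Definition c0_ModuleSpace_mixin : ModuleSpace.mixin_of C_Ring c0_AbelianGroup.
Proof.
apply (ModuleSpace.Mixin C_Ring c0_AbelianGroup c0_scal);
  intros; apply c0_eq; intros k; simpl;
  try change mult with Cmult; try change (@one C_Ring) with (RtoC 1);
  try change (@plus C_Ring) with Cplus; ring.
Defined.

Canonical c0_ModuleSpace :=
  ModuleSpace.Pack C_Ring (c0 r) (ModuleSpace.Class _ _ _ c0_ModuleSpace_mixin) (c0 r).

Definition c0_ball (x : c0 r) (e : R) (y : c0 r) : Prop :=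
  (c0_norm (@minus c0_AbelianGroup y x) < e)%R.

Definition c0_UniformSpace_mixin : UniformSpace.mixin_of (c0 r).
Proof.
apply (UniformSpace.Mixin (c0 r) c0_zero c0_ball); unfold c0_ball.
- intros x e; rewrite (minus_eq_zero (G := c0_AbelianGroup)).
  change zero with c0_zero; rewrite c0_norm_zero; apply cond_pos.
- intros x y e H; apply Rle_lt_trans with (2 := H).
  rewrite <- (opp_minus (G := c0_AbelianGroup)).
  apply c0_norm_le; intros k; simpl; rewrite Cmod_opp.
  exact (c0_norm_ub (@minus c0_AbelianGroup y x) k).
- intros x y z e1 e2 H1 H2.
  rewrite (minus_trans (G := c0_AbelianGroup) y z x).
  apply Rle_lt_trans with (1 := c0_norm_triangle _ _); lra.
Defined.

Canonical c0_UniformSpace := UniformSpace.Pack (c0 r) c0_UniformSpace_mixin (c0 r).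

Canonical c0_NormedModuleAux :=
  NormedModuleAux.Pack C_AbsRing (c0 r)
    (NormedModuleAux.Class _ _ (ModuleSpace.class _ c0_ModuleSpace)
       (UniformSpace.class c0_UniformSpace)) (c0 r).

Definition c0_NormedModule_mixin : NormedModule.mixin_of C_AbsRing c0_NormedModuleAux.
Proof.
apply (NormedModule.Mixin C_AbsRing c0_NormedModuleAux c0_norm 1).
- exact c0_norm_triangle.
- exact c0_norm_scal.
- intros x y e H; exact H.
- intros x y e H; rewrite Rmult_1_l; exact H.
- exact c0_norm_eq_0.
Defined.

Canonical c0_NormedModule :=
  NormedModule.Pack C_AbsRing (c0 r)
    (NormedModule.Class _ _ _ c0_NormedModule_mixin) (c0 r).

End C0Space.

Definition rhaly (a : nat -> C) (x : nat -> C) (n : nat) : C :=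
  (a n * sum_n x n)%C.

(* [T] is the operator from c0 r to c0 s induced by R_a.  Such a [T] exists iff R_a
   maps c0 r into c0 s, and it is then unique. *)
Definition is_rhaly (a : nat -> C) (r s : nat -> posreal) (T : c0 r -> c0 s) : Prop :=
  forall (x : c0 r) (n : nat), T x n = rhaly a x n.

(* [is_linear] is Coquelicot's notion of bounded linear operator: it includes the
   bound  norm (T x) <= M * norm x. *)
Definition rhaly_bounded (a : nat -> C) (r s : nat -> posreal) : Prop :=
  exists T : c0 r -> c0 s, is_rhaly a r s T /\ is_linear T.

Definition op_norm {K : AbsRing} {U V : NormedModule K} (T : U -> V) : Rbar :=
  Lub_Rbar (fun t : R => exists x : U, (norm x <= 1)%R /\ t = norm (T x)).

(* Main.v *)
(** With [b n = s n |a n| sum_(k <= n) 1 / r k], the estimate [|x k| <= norm x / r k] gives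
    [|(R_a x) n| s n <= b n * norm x], and the truncation of [1 / r] to the indices up to [n],
    which has norm 1, shows that the constant [b n] is attained.  If [b] is bounded then [R_a x]
    does lie in [c0 s]: since [r] is bounded, the weights [1 / r k] have divergent sum, so their
    weighted means of the null sequence [r k |x k|] tend to 0. *)
Require Import Defs.
From Stdlib Require Import Reals Lra Lia.
From Coquelicot Require Import Coquelicot.

(** Passes from the complex filter limit in [c0_lim] to a real null sequence, where epsilon
    arguments can be run. *)
Lemma c0_lim_iff (r : nat -> posreal) (x : nat -> C) :
  filterlim (fun k => (RtoC (r k) * x k)%C) eventually (locally (RtoC 0)) <->
  is_lim_seq (fun k => (Cmod (x k) * r k)%R) 0.
Proof.
assert (E : forall k, Cmod (RtoC (r k) * x k)%C = (Cmod (x k) * r k)%R).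
{ intros k; rewrite Cmod_mult, Cmod_R, Rabs_pos_eq by apply Rlt_le, cond_pos; ring. }
split; intros H.
- apply is_lim_seq_ext with (1 := E).
  rewrite <- Cmod_0.
  exact (filterlim_comp _ _ _ _ _ _ _ _ H (@filterlim_norm _ C_NormedModule (RtoC 0))).
- apply (@filterlim_norm_zero nat C_AbsRing C_NormedModule eventually _
           (fun k => (RtoC (r k) * x k)%C)).
  refine (is_lim_seq_ext _ _ 0 _ H); intros k; symmetry; apply E.
Qed.

Definition recip_sum (r : nat -> posreal) (n : nat) : R := sum_n (fun k => / r k)%R n.

Lemma recip_sum_Sn (r : nat -> posreal) (n : nat) :
  recip_sum r (S n) = (recip_sum r n + / r (S n))%R.
Proof. exact (sum_Sn _ _). Qed.

Lemma recip_sum_pos (r : nat -> posreal) (n : nat) : (0 < recip_sum r n)%R.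
Proof.
induction n as [|n IH].
- unfold recip_sum; rewrite sum_O; apply Rinv_0_lt_compat, cond_pos.
- rewrite recip_sum_Sn; apply Rplus_lt_0_compat; [exact IH|].
  apply Rinv_0_lt_compat, cond_pos.
Qed.

(** An upper bound [B] for [r] makes each term at least [/ B], so the sums grow at least
    linearly. *)
Lemma recip_sum_lim (r : nat -> posreal) :
  bounded_seq (fun n => r n : R) -> is_lim_seq (recip_sum r) p_infty.
Proof.
intros [B HB].
assert (HB' : forall n, (r n <= B)%R).
{ intros n; apply Rle_trans with (1 := Rle_abs _); exact (HB n). }
assert (B0 : (0 < B)%R) by (apply Rlt_le_trans with (2 := HB' 0%nat), cond_pos).
apply is_lim_seq_le_p_loc with (fun n => (/ B * INR n)%R).
(* [recip_sum r n] has n + 1 terms; the comparison drops one of them, so it starts from 0 at n =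
   0. *)
- exists 0%nat; intros n _; induction n as [|n IH].
  + simpl; rewrite Rmult_0_r; apply Rlt_le, recip_sum_pos.
  + rewrite recip_sum_Sn, S_INR.
    assert (/ B <= / r (S n))%R by (apply Rinv_le_contravar; [apply cond_pos | apply HB']).
    lra.
- replace p_infty with (Rbar_mult (/ B) p_infty).
  + apply is_lim_seq_scal_l, is_lim_seq_INR.
  + apply is_Rbar_mult_unique, is_Rbar_mult_sym, is_Rbar_mult_p_infty_pos.
    simpl; apply Rinv_0_lt_compat, B0.
Qed.

(** Each term past [N] adds at most [e / r k], while [K] absorbs the head. It serves twice: with
    [K = 0] and [e] the norm for the operator bound, and with small [e] for the limit. *)
Lemma Cmod_sum_n_le (r : nat -> posreal) (x : nat -> C) (e K : R) (N : nat) :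
  (Cmod (sum_n x N) <= K + e * recip_sum r N)%R ->
  (forall k, (N < k)%nat -> (Cmod (x k) * r k <= e)%R) ->
  forall n, (N <= n)%nat -> (Cmod (sum_n x n) <= K + e * recip_sum r n)%R.
Proof.
intros H0 Hx n Hn; induction Hn as [|n Hn IH]; [exact H0|].
rewrite recip_sum_Sn, sum_Sn.
apply Rle_trans with (1 := Cmod_triangle _ _).
assert (Hr := cond_pos (r (S n))).
assert (Cmod (x (S n)) <= e * / r (S n))%R.
{ apply Rmult_le_reg_r with (1 := Hr).
  rewrite Rmult_assoc, Rinv_l, Rmult_1_r by lra.
  apply Hx; lia. }
lra.
Qed.

Lemma Cmod_sum_n_c0 (r : nat -> posreal) (x : c0 r) (n : nat) :
  (Cmod (sum_n x n) <= c0_norm r x * recip_sum r n)%R.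
Proof.
rewrite <- (Rplus_0_l (_ * _)).
apply Cmod_sum_n_le with (N := 0%nat); [| intros k _; apply c0_norm_ub | lia].
unfold recip_sum; rewrite !sum_O.
assert (Hr := cond_pos (r 0%nat)).
apply Rmult_le_reg_r with (1 := Hr).
rewrite Rplus_0_l, Rmult_assoc, Rinv_l, Rmult_1_r by lra.
apply c0_norm_ub.
Qed.

Definition rhaly_weight (a : nat -> C) (r s : nat -> posreal) (n : nat) : R :=
  (s n * Cmod (a n) * recip_sum r n)%R.

Lemma rhaly_weight_pos (a : nat -> C) (r s : nat -> posreal) (n : nat) :
  (0 <= rhaly_weight a r s n)%R.
Proof.
apply Rmult_le_pos; [apply Rmult_le_pos|].
- apply Rlt_le, cond_pos.
- apply Cmod_ge_0.
- apply Rlt_le, recip_sum_pos.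
Qed.

Lemma bounded_rhaly_weight (a : nat -> C) (r s : nat -> posreal) :
  bounded_seq (fun n => (RtoC (s n) * a n * RtoC (sum_n (fun k => / r k)%R n))%C) <->
  exists M, forall n, (rhaly_weight a r s n <= M)%R.
Proof.
assert (E : forall n,
  Cmod (RtoC (s n) * a n * RtoC (sum_n (fun k => / r k)%R n))%C = rhaly_weight a r s n).
{ intros n; rewrite !Cmod_mult, !Cmod_R, !Rabs_pos_eq.
  - reflexivity.
  - apply Rlt_le, recip_sum_pos.
  - apply Rlt_le, cond_pos. }
split; intros [M HM]; exists M; intros n; specialize (HM n).
- rewrite <- E; exact HM.
- rewrite <- E in HM; exact HM.
Qed.

Lemma rhaly_le (a : nat -> C) (r s : nat -> posreal) (x : c0 r) (n : nat) :
  (Cmod (rhaly a x n) * s n <= rhaly_weight a r s n * c0_norm r x)%R.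
Proof.
unfold rhaly, rhaly_weight; rewrite Cmod_mult.
assert (Hw : (0 <= s n * Cmod (a n))%R).
{ apply Rmult_le_pos; [apply Rlt_le, cond_pos | apply Cmod_ge_0]. }
assert (H := Rmult_le_compat_l _ _ _ Hw (Cmod_sum_n_c0 r x n)).
lra.
Qed.

(** Beyond some [N] the weighted terms of [x] are below [e]. The fixed head sum is eventually below
    [e * recip_sum r n] by divergence, so the partial sum is at most [2 * e * recip_sum r n], and
    the weight bound turns this into at most [2 * e * M]. *)
Lemma rhaly_c0 (a : nat -> C) (r s : nat -> posreal) (M : R) :
  bounded_seq (fun n => r n : R) ->
  (forall n, (rhaly_weight a r s n <= M)%R) ->
  forall x : c0 r,
  filterlim (fun k => (RtoC (s k) * rhaly a x k)%C) eventually (locally (RtoC 0)).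
Proof.
intros hr HM x; apply c0_lim_iff, is_lim_seq_spec; intros eps.
assert (Heps := cond_pos eps).
assert (M0 : (0 <= M)%R)
  by (apply Rle_trans with (1 := rhaly_weight_pos a r s 0), HM).
(* Chosen so that [2 * e * M = eps - 2 * e < eps]; the [+ 1] keeps the denominator positive when
   [M = 0]. *)
set (e := (eps / (2 * (M + 1)))%R).
assert (e0 : (0 < e)%R) by (apply Rdiv_lt_0_compat; lra).
assert (eM : (e * (M + 1) = eps / 2)%R) by (unfold e; field; lra).
destruct (proj2 (is_lim_seq_spec _ _) (proj1 (c0_lim_iff r x) (c0_lim r x))
            (mkposreal e e0)) as [N HN]; simpl in HN.
set (K := Cmod (sum_n x N)).
assert (K0 : (0 <= K)%R) by apply Cmod_ge_0.
(* From [N'] on, [recip_sum r n] exceeds [K / e], so the head [K] costs no more than a second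
   [e * recip_sum r n]. *)
destruct (proj2 (is_lim_seq_spec _ _) (recip_sum_lim r hr) (K / e)%R) as [N' HN'].
exists (max N N'); intros n Hn.
assert (Hx : (Cmod (sum_n x n) <= K + e * recip_sum r n)%R).
{ apply Cmod_sum_n_le with N; [| | lia].
  - assert (H := Rmult_lt_0_compat _ _ e0 (recip_sum_pos r N)); fold K; lra.
  - intros k Hk; specialize (HN k ltac:(lia)).
    rewrite Rminus_0_r in HN.
    apply Rle_trans with (1 := Rle_abs _); lra. }
assert (HK : (K < e * recip_sum r n)%R).
{ specialize (HN' n ltac:(lia)).
  apply Rmult_lt_compat_l with (1 := e0) in HN'.
  replace (e * (K / e))%R with K in HN' by (field; lra); exact HN'. }
assert (Hw : (0 <= s n * Cmod (a n))%R)
  by (apply Rmult_le_pos; [apply Rlt_le, cond_pos | apply Cmod_ge_0]).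
assert (Hb := HM n); unfold rhaly_weight in Hb.
unfold rhaly; rewrite Rminus_0_r, Cmod_mult, Rabs_pos_eq.
- apply Rle_lt_trans with (s n * Cmod (a n) * (2 * e * recip_sum r n))%R.
  + apply Rle_trans with (s n * Cmod (a n) * Cmod (sum_n x n))%R; [lra|].
    apply Rmult_le_compat_l; [exact Hw | lra].
  + apply Rmult_le_compat_l with (r := (2 * e)%R) in Hb; lra.
- apply Rmult_le_pos; [|apply Rlt_le, cond_pos].
  apply Rmult_le_pos; apply Cmod_ge_0.
Qed.

Lemma rhaly_bounded_of_weight (a : nat -> C) (r s : nat -> posreal) (M : R) :
  bounded_seq (fun n => r n : R) ->
  (forall n, (rhaly_weight a r s n <= M)%R) -> rhaly_bounded a r s.
Proof.
intros hr HM.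
exists (fun x : c0 r => mk_c0 s (rhaly a x) (rhaly_c0 a r s M hr HM x)).
split; [intros x n; reflexivity|].
split.
- intros x y; apply c0_eq; intros n; simpl; unfold rhaly.
  assert (E := sum_n_plus (G := C_AbelianMonoid) x y n).
  change (sum_n (fun k => (x k + y k)%C) n = (sum_n x n + sum_n y n)%C) in E.
  rewrite E; ring.
- intros c x; apply c0_eq; intros n; simpl; unfold rhaly.
  assert (E := sum_n_mult_l (K := C_Ring) c x n).
  change (sum_n (fun k => (c * x k)%C) n = (c * sum_n x n)%C) in E.
  rewrite E; ring.
(* [is_linear] asks for a strictly positive constant, and [M] may be 0. *)
- exists (M + 1)%R.
  assert (M0 : (0 <= M)%R)
    by (apply Rle_trans with (1 := rhaly_weight_pos a r s 0), HM).
  split; [lra|]; intros x.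
  apply c0_norm_le; intros n; simpl.
  apply Rle_trans with (1 := rhaly_le a r s x n).
  apply Rmult_le_compat_r; [apply c0_norm_pos | specialize (HM n); lra].
Qed.

Definition recip_trunc (r : nat -> posreal) (n k : nat) : C :=
  if Nat.leb k n then RtoC (/ r k) else RtoC 0.

Lemma recip_trunc_lim (r : nat -> posreal) (n : nat) :
  filterlim (fun k => (RtoC (r k) * recip_trunc r n k)%C) eventually (locally (RtoC 0)).
Proof.
apply filterlim_ext_loc with (fun _ : nat => RtoC 0).
- exists (S n); intros k Hk; unfold recip_trunc.
  replace (Nat.leb k n) with false by (symmetry; apply Nat.leb_gt; lia).
  ring.
- apply filterlim_const.
Qed.

Definition c0_recip_trunc (r : nat -> posreal) (n : nat) : c0 r :=
  mk_c0 r _ (recip_trunc_lim r n).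

Lemma c0_norm_recip_trunc (r : nat -> posreal) (n : nat) :
  (c0_norm r (c0_recip_trunc r n) <= 1)%R.
Proof.
apply c0_norm_le; intros k; simpl; unfold recip_trunc.
assert (Hr := cond_pos (r k)).
destruct (Nat.leb k n); rewrite Cmod_R.
- rewrite Rabs_pos_eq by (apply Rlt_le, Rinv_0_lt_compat, Hr).
  rewrite Rinv_l; lra.
- rewrite Rabs_R0; lra.
Qed.

Lemma sum_n_recip_trunc (r : nat -> posreal) (n : nat) :
  sum_n (recip_trunc r n) n = RtoC (recip_sum r n).
Proof.
transitivity (sum_n (fun k => RtoC (/ r k)) n).
- apply (sum_n_ext_loc (G := C_AbelianMonoid)); intros k Hk; unfold recip_trunc.
  rewrite (proj2 (Nat.leb_le k n) Hk); reflexivity.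
- clear; induction n as [|n IH].
  + unfold recip_sum; rewrite !sum_O; reflexivity.
  + rewrite sum_Sn, IH, recip_sum_Sn, RtoC_plus; reflexivity.
Qed.

(** On the truncated reciprocals the partial sum up to [n] is exactly [recip_sum r n], so coordinate
    [n] of the image has weighted modulus equal to the weight. *)
Lemma rhaly_weight_le_norm (a : nat -> C) (r s : nat -> posreal) (T : c0 r -> c0 s) (n : nat) :
  is_rhaly a r s T -> (rhaly_weight a r s n <= c0_norm s (T (c0_recip_trunc r n)))%R.
Proof.
intros HT; apply Rle_trans with (2 := c0_norm_ub s _ n).
rewrite HT; unfold rhaly, rhaly_weight; simpl.
rewrite sum_n_recip_trunc, Cmod_mult, Cmod_R, Rabs_pos_eq by apply Rlt_le, recip_sum_pos.
lra.
Qed.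

Lemma op_norm_rhaly (a : nat -> C) (r s : nat -> posreal) (T : c0 r -> c0 s) :
  is_rhaly a r s T ->
  op_norm T = Sup_seq (fun n => Finite (rhaly_weight a r s n)).
Proof.
intros HT; apply is_lub_Rbar_unique; split.
- intros t [x [Hx ->]].
  change (Rbar_le (c0_norm s (T x)) (Sup_seq (fun n => rhaly_weight a r s n))).
  (* With the norm written as a supremum again, the two suprema are compared term by term, using
     [norm x <= 1]. *)
  rewrite <- (is_sup_seq_unique _ _ (c0_norm_lub s (T x))).
  apply Sup_seq_le; intros n; simpl; rewrite HT.
  apply Rle_trans with (1 := rhaly_le a r s x n).
  rewrite <- (Rmult_1_r (rhaly_weight a r s n)) at 2.
  apply Rmult_le_compat_l; [apply rhaly_weight_pos | exact Hx].
- intros b Hb.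
  (* It suffices to bound each single weight by [b]; the test vector for [n] lies in the unit ball
     and its image has norm at least that weight. *)
  apply (is_sup_seq_lub _ _ (Sup_seq_correct _)); intros t [n ->].
  apply Rbar_le_trans with (c0_norm s (T (c0_recip_trunc r n))).
  + apply rhaly_weight_le_norm, HT.
  + apply Hb; exists (c0_recip_trunc r n); split; [apply c0_norm_recip_trunc | reflexivity].
Qed.

Theorem theorem3p1 (a : nat -> C) (r s : nat -> posreal)
    (hr : bounded_seq (fun n => r n : R)) (hs : bounded_seq (fun n => s n : R)) :
  (rhaly_bounded a r s <->
     bounded_seq (fun n => (RtoC (s n) * a n * RtoC (sum_n (fun k => / r k)%R n))%C))
  /\
  (forall T : c0 r -> c0 s, is_rhaly a r s T -> is_linear T ->
     op_norm T =
       Sup_seq (fun n => Finite (s n * Cmod (a n) * sum_n (fun k => / r k) n)%R)).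
Proof.
split; [rewrite bounded_rhaly_weight; split|].
(* The continuity constant of [T], tested on the truncated reciprocals, bounds every weight. *)
- intros [T [HT [_ _ [M [M0 HM]]]]]; exists M; intros n.
  apply Rle_trans with (1 := rhaly_weight_le_norm a r s T n HT).
  apply Rle_trans with (1 := HM (c0_recip_trunc r n)).
  rewrite <- (Rmult_1_r M) at 2.
  apply Rmult_le_compat_l; [lra | apply c0_norm_recip_trunc].
- intros [M HM]; exact (rhaly_bounded_of_weight a r s M hr HM).
- intros T HT _; exact (op_norm_rhaly a r s T HT).
Qed.
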